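(* Let $k$ be a field and let $\Delta$ be a simplicial complex on the vertex set $[n]$ with $\{i\}\in\Delta$ for all $i\in[n]$. Let $G(I_\Delta)=\{u_1,\ldots,u_\ell\}$ be the minimal set of monomial generators of $I_\Delta$ and let $\mathcal{F}_\Delta=\{\mathrm{supp}(u_j)\mid j=1,\ldots,\ell\}$. (A) Assume that $\Delta=\mathrm{core}\,\Delta$ and that $k[\Delta]$ is not a complete intersection. Then $k[\Delta]$ is a generalized complete intersection if and only if all of the following conditions hold: (1) For every $S\in\mathcal{F}_\Delta$ with $|S|\geq 3$ there exists a non-empty set $\mathcal{C}(S)\subset[n]$ such that (a) $\mathcal{C}(S)\cap S=\emptyset$; (b) for every $i\in\mathcal{C}(S)$ we have $E_{ij}:=\{i,j\}\in\mathcal{F}_\Delta$ for all $j\in S$; moreover, if $T\in\mathcal{F}_\Delta$, $T\neq S$, satisfies $S\cap T\neq\emptyset$, then $T=E_{ij}$ for some $i\in\mathcal{C}(S)$ and $j\in S$; (c) for every $k\in[n]$ with $k\notin\mathcal{C}(S)\cup S$ we have $\{i,k\}\in\mathcal{F}_\Delta$ for all $i\in\mathcal{C}(S)$. (2) Any two elements $i,j\in[n]$ are linked by a path $P=\{\{i_p,i_{p+1}\}\mid p=1,\ldots,r\}$ with edges $\{i_p,i_{p+1}\}\in\mathcal{F}_\Delta$ for $p=1,\ldots,r$, such that $i=i_1$ and $j=i_{r+1}$. (3) If there exists a length $4$ path $P=\{\{i_p,i_{p+1}\}\in\mathcal{F}_\Delta\mid p=1,2,3,4\}$ (consisting of four pairwise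 distinct edges), then there is an edge $\{i_1,i_q\}\in\mathcal{F}_\Delta$ with $q=3$, $4$ or $5$. (4) For every vertex $i$ of $G_\Delta$ consider a subgraph $H_i\subset G_\Delta$ such that (a) $H_i\cong\mathcal{K}_{r_i}$ and $i\in V(H_i)$; (b) $V(H_i)$ contains no subset $S\in\mathcal{F}_\Delta$ with $|S|\geq 3$; and (c) $r_i$ is maximal among all such subgraphs. Then $r_i$ is constant for all $i$. (B) If $\Delta\neq\mathrm{core}\,\Delta$, then $k[\Delta]$ is a generalized complete intersection if and only if it is a complete intersection.
   Context: $[n]=\{1,\ldots,n\}$. $I_\Delta\subset k[X_1,\ldots,X_n]$ is the Stanley-Reisner ideal, generated by the square-free monomials $\prod_{i\in F}X_i$ with $F\subset[n]$, $F\notin\Delta$, and $k[\Delta]=k[X_1,\ldots,X_n]/I_\Delta$. The support of a monomial is $\mathrm{supp}(u)=\{i\mid X_i \text{ divides } u\}$, so $\mathcal{F}_\Delta$ is the set of minimal non-faces of $\Delta$. For $F\in\Delta$: $\mathrm{lk}_\Delta(F)=\{G\mid G\cup F\in\Delta,\ G\cap F=\emptyset\}$ and $\mathrm{star}_\Delta(F)=\{G\mid G\cup F\in\Delta\}$. Put $\mathrm{core}[n]=\{i\in[n]\mid \mathrm{star}_\Delta(\{i\})\neq\Delta\}$ and $\mathrm{core}\,\Delta=\{F\cap\mathrm{core}[n]\mid F\in\Delta\}$. $\Delta$ is pure if all facets have the same dimension. A Stanley-Reisner ring is a complete intersection if its Stanley-Reisner ideal is generated by a regular sequence of the polynomial ring.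 $k[\Delta]$ is a generalized complete intersection (gCI) if $\Delta$ is pure and $k[\mathrm{lk}_\Delta(\{i\})]$ is a complete intersection for all $i\in[n]$. An edge is an element $E\in\mathcal{F}_\Delta$ with $|E|=2$. A path is a set $\{E_1,\ldots,E_q\}$ of edges with $E_p\cap E_{p+1}\neq\emptyset$ for $p=1,\ldots,q-1$. $G_\Delta$ is the graph with vertex set $V(G_\Delta)=[n]$ and edge set $E(G_\Delta)=\{\{i,j\}\mid i\neq j,\ \{i,j\}\notin\mathcal{F}_\Delta\}$ (the $1$-skeleton of $\Delta$). $\mathcal{K}_r$ is the complete graph on $r$ vertices and $V(H)$ is the vertex set of a graph $H$. *)

(* Defs.v *)
From HB Require Import structures.
From mathcomp Require Import all_boot all_order all_algebra.
From mathcomp Require Export mpoly.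

Set Implicit Arguments.
Unset Strict Implicit.
Unset Printing Implicit Defensive.

Import GRing.Theory.
Local Open Scope ring_scope.

(* Ideals are Prop-valued predicates, compared extensionally with <->. *)

Definition ideal_gen (R : comNzRingType) (A : R -> Prop) (p : R) : Prop :=
  exists s : seq (R * R),
    (forall x, x \in s -> A x.2) /\ p = \sum_(x <- s) x.1 * x.2.

Definition seq_ideal (R : comNzRingType) (fs : seq R) : R -> Prop :=
  ideal_gen (fun f => f \in fs).

Definition regular_sequence (R : comNzRingType) (fs : seq R) : Prop :=
  (forall j p, (j < size fs)%N ->
     seq_ideal (take j fs) (p * fs`_j) -> seq_ideal (take j fs) p)
  /\ ~ seq_ideal fs 1.

(* The paper's vertex set {1, ..., n} is 'I_n. *)

Definition simplicial_complex n (D : {set {set 'I_n}}) : Prop :=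
  set0 \in D /\
  (forall F G : {set 'I_n}, F \in D -> G \subset F -> G \in D).

Definition link n (D : {set {set 'I_n}}) (F : {set 'I_n}) : {set {set 'I_n}} :=
  [set G : {set 'I_n} | (G :|: F \in D) && (G :&: F == set0)].

Definition star n (D : {set {set 'I_n}}) (F : {set 'I_n}) : {set {set 'I_n}} :=
  [set G : {set 'I_n} | G :|: F \in D].

Definition core_vertices n (D : {set {set 'I_n}}) : {set 'I_n} :=
  [set i | star D [set i] != D].

Definition core n (D : {set {set 'I_n}}) : {set {set 'I_n}} :=
  [set F :&: core_vertices D | F in D].

Definition facet n (D : {set {set 'I_n}}) (F : {set 'I_n}) : bool :=
  maxset (fun G => G \in D) F.

Definition pure n (D : {set {set 'I_n}}) : Prop :=
  forall F G : {set 'I_n}, facet D F -> facet D G -> #|F| = #|G|.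

Definition SR_ideal (k : fieldType) n (D : {set {set 'I_n}}) :
    {mpoly k[n]} -> Prop :=
  ideal_gen (fun f => exists2 F : {set 'I_n},
    F \notin D & f = \prod_(i in F) 'X_i).

(* Stanley-Reisner ideals are always taken in the polynomial ring on all of
   'I_n: a vertex j with [set j] \notin D contributes the generator 'X_j.
   This matters for links. *)
Definition complete_intersection (k : fieldType) n (D : {set {set 'I_n}}) :
    Prop :=
  exists2 fs : seq {mpoly k[n]}, regular_sequence fs &
    forall p, SR_ideal D p <-> seq_ideal fs p.

Definition generalized_complete_intersection (k : fieldType) n
    (D : {set {set 'I_n}}) : Prop :=
  pure D /\ forall i : 'I_n, complete_intersection k (link D [set i]).

Definition monomial_ideal (k : fieldType) n (G : seq 'X_{1..n}) :
    {mpoly k[n]} -> Prop :=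
  seq_ideal [seq 'X_[u] | u <- G].

Definition minimal_monomial_generators (k : fieldType) n
    (I : {mpoly k[n]} -> Prop) (G : seq 'X_{1..n}) : Prop :=
  [/\ uniq G,
      forall p, I p <-> monomial_ideal G p &
      forall G' : seq 'X_{1..n}, {subset G' <= G} ->
        (forall p, I p <-> @monomial_ideal k n G' p) -> {subset G <= G'}].

Definition supp n (u : 'X_{1..n}) : {set 'I_n} := [set i | (0 < u i)%N].

Definition supports n (G : seq 'X_{1..n}) : {set {set 'I_n}} :=
  [set S | S \in [seq supp u | u <- G]].

(* An edge is a two-element set of vertices. *)
Record graph (T : finType) := Graph {
  vertices : {set T};
  edges : {set {set T}};
  edgesP : [forall e in edges, (e \subset vertices) && (#|e| == 2)] }.

Definition subgraph (T : finType) (H G : graph T) : Prop :=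
  vertices H \subset vertices G /\ edges H \subset edges G.

Definition graph_iso (T U : finType) (G : graph T) (H : graph U) : Prop :=
  exists f : T -> U,
    [/\ {in vertices G &, injective f},
        f @: vertices G = vertices H &
        {in vertices G &, forall x y, x != y ->
           ([set x; y] \in edges G) = ([set f x; f y] \in edges H)}].

Lemma complete_graph_edgesP (r : nat) :
  [forall e in [set e : {set 'I_r} | #|e| == 2],
     (e \subset [set: 'I_r]) && (#|e| == 2)].
Proof. by apply/forall_inP => e; rewrite inE subsetT. Qed.

Definition complete_graph (r : nat) : graph 'I_r :=
  Graph (complete_graph_edgesP r).

Lemma skeleton_edgesP n (F : {set {set 'I_n}}) :
  [forall e in [set e : {set 'I_n} | (#|e| == 2) && (e \notin F)],
     (e \subset [set: 'I_n]) && (#|e| == 2)].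
Proof. by apply/forall_inP => e; rewrite inE subsetT => /andP[->]. Qed.

(* The graph G_Delta, where F is the family of minimal non-faces of Delta. *)
Definition skeleton_graph n (F : {set {set 'I_n}}) : graph 'I_n :=
  Graph (skeleton_edgesP F).

Definition admissible_subgraph n (F : {set {set 'I_n}}) (i : 'I_n) (r : nat)
    (H : graph 'I_n) : Prop :=
  [/\ subgraph H (skeleton_graph F),
      graph_iso H (complete_graph r),
      i \in vertices H &
      forall S : {set 'I_n}, S \in F -> (3 <= #|S|)%N ->
        ~~ (S \subset vertices H)].

Definition maximal_order n (F : {set {set 'I_n}}) (i : 'I_n) (r : nat) :
    Prop :=
  (exists H, admissible_subgraph F i r H) /\
  (forall r' H, admissible_subgraph F i r' H -> (r' <= r)%N).

Definition isolating_condition n (F : {set {set 'I_n}}) : Prop :=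
  forall S : {set 'I_n}, S \in F -> (3 <= #|S|)%N ->
  exists C : {set 'I_n},
    [/\ C != set0,
        C :&: S = set0,
        (forall i, i \in C -> forall j, j \in S -> [set i; j] \in F) /\
        (forall T : {set 'I_n}, T \in F -> T != S -> S :&: T != set0 ->
           exists i j, [/\ i \in C, j \in S & T = [set i; j]]) &
        forall l, l \notin C :|: S -> forall i, i \in C -> [set i; l] \in F].

Definition linked_condition n (F : {set {set 'I_n}}) : Prop :=
  forall i j : 'I_n, i != j ->
  exists p : seq 'I_n, path (fun a b => [set a; b] \in F) i p /\ last i p = j.

Definition length4_path_condition n (F : {set {set 'I_n}}) : Prop :=
  forall i1 i2 i3 i4 i5 : 'I_n,
    [set i1; i2] \in F -> [set i2; i3] \in F ->
    [set i3; i4] \in F -> [set i4; i5] \in F ->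
    uniq [:: [set i1; i2]; [set i2; i3]; [set i3; i4]; [set i4; i5]] ->
    [\/ [set i1; i3] \in F, [set i1; i4] \in F | [set i1; i5] \in F].

Definition constant_order_condition n (F : {set {set 'I_n}}) : Prop :=
  forall (i j : 'I_n) (r s : nat),
    maximal_order F i r -> maximal_order F j s -> r = s.

(* Main.v *)
Require Import Defs.
From mathcomp Require Import all_boot all_algebra.

(** The theorem is a statement about the family F of minimal non-faces of D.
    The exponents of a minimal set of monomial generators of the
    Stanley-Reisner ideal I are exactly the indicator vectors of the members
    of F (supports_min_generators), and I is generated by a regular sequence
    if and only if the members of F are pairwise disjoint
    (trivIset_complete_intersection, complete_intersection_trivIset).

    One direction of the latter holds because pairwise coprime monomials form
    a regular sequence.  For the other, the regular sequence f is arbitrary,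
    not necessarily homogeneous.  Write the minimal generators as u = A f and
    f = B u.  Minimality forces the constant terms of A B to be those of the
    identity matrix, and every syzygy of a regular sequence has its
    coefficients in I (regular_syzygy).  If S and T are distinct members of F
    that meet, then X^(T - S) u_S = X^(S - T) u_T gives a syzygy of f; applying
    B to it yields an element of I in which the monomial X^(T - S) has
    coefficient 1.  So T - S is a non-face properly contained in T, which is
    absurd.

    The minimal non-faces of the link of i are {i} and the minimal members of
    the family of all S - i with S in F.  Hence a generalized complete
    intersection is a pure complex for which these derived families are
    disjoint for every i (links_disjoint).  If S and T in F are distinct and
    meet, and i is a vertex outside T, they cannot both leave minimal traces in
    the link of i: some U in F through i has U - i contained in T, or in S when
    i is outside S as well (links_meet_outside).  The isolating, linked and
    length-four conditions follow by choosing S, T and i suitably; only the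
    linked and isolating ones also need that two members of F meet, which is
    where the failure of D to be a complete intersection enters.

    Complete intersections are pure, since the complement of a facet picks one
    vertex from each minimal non-face (facet_codim).  Applied to links, this
    says that all facets through a given vertex i have the same size, which is
    the number r_i of the constant-order condition; so, once the links are
    complete intersections, that condition is purity.

    Conversely, two minimal non-faces of the link of i that meet come, by the
    isolating condition, from two edges z - a and z - c with i adjacent to none
    of a, z, c.  Walking from i to z, the length-four condition leaves only one
    configuration: x - y - z with z - a and z - c, where x is not adjacent to
    a, z, c and a is not adjacent to c.  In this spider, replacing z by a and c
    turns every face through z into a face through a with one more vertex
    (spider_face), which contradicts the constant-order condition.

    If D is not its own core, some vertex i lies in no minimal non-face.  Then
    all members of F remain minimal non-faces in the link of i, so disjointness
    in that link gives disjointness in D. *)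

Set Implicit Arguments.
Unset Strict Implicit.
Unset Printing Implicit Defensive.

Import GRing.Theory.
Local Open Scope ring_scope.

(** * Ideals, regular sequences and monomial ideals *)

Lemma ideal_gen_ext (R : comNzRingType) (A B : R -> Prop) :
  (forall f, A f <-> B f) -> forall p, ideal_gen A p <-> ideal_gen B p.
Proof.
by move=> AB p; split=> -[s [As ->]]; exists s; split=> // x /As /AB.
Qed.

Lemma ideal_gen0 (R : comNzRingType) (A : R -> Prop) : ideal_gen A 0.
Proof. by exists [::]; rewrite big_nil. Qed.

Lemma ideal_genD (R : comNzRingType) (A : R -> Prop) p q :
  ideal_gen A p -> ideal_gen A q -> ideal_gen A (p + q).
Proof.
move=> [s [As ->]] [t [At ->]]; exists (s ++ t); rewrite big_cat; split=> // x.
by rewrite mem_cat => /orP[/As|/At].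
Qed.

Lemma ideal_genMl (R : comNzRingType) (A : R -> Prop) a p :
  ideal_gen A p -> ideal_gen A (a * p).
Proof.
move=> [s [As ->]]; exists [seq (a * x.1, x.2) | x <- s]; split.
  by move=> _ /mapP[x /As Ax ->].
by rewrite big_map mulr_sumr; apply: eq_bigr => x _; rewrite mulrA.
Qed.

Lemma ideal_gen_mem (R : comNzRingType) (A : R -> Prop) p :
  A p -> ideal_gen A p.
Proof.
move=> Ap; exists [:: (1, p)]; rewrite big_seq1 mul1r; split=> // x.
by rewrite inE => /eqP->.
Qed.

Lemma ideal_gen_sum (R : comNzRingType) (A : R -> Prop) (I : Type) (r : seq I)
    (P : pred I) (F : I -> R) :
  (forall i, P i -> ideal_gen A (F i)) -> ideal_gen A (\sum_(i <- r | P i) F i).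
Proof.
by move=> AF; elim/big_ind: _ => //; [exact: ideal_gen0 | exact: ideal_genD].
Qed.

Lemma ideal_gen_min (R : comNzRingType) (A B : R -> Prop) :
  (forall f, A f -> ideal_gen B f) -> forall p, ideal_gen A p -> ideal_gen B p.
Proof.
move=> AB p [s [As ->]]; rewrite big_seq.
by apply: ideal_gen_sum => x /As /AB; apply: ideal_genMl.
Qed.

Lemma ideal_gen_finP (R : comNzRingType) (I : finType) (P : pred I)
    (g : I -> R) p :
  ideal_gen (fun f => exists2 i, P i & f = g i) p <->
  exists a : I -> R, p = \sum_(i | P i) a i * g i.
Proof.
split=> [[s [As ->]]|[a ->]]; last first.
  apply: ideal_gen_sum => i Pi; apply/ideal_genMl/ideal_gen_mem.
  by exists i.
elim: s As => [_|x s IH As].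
  by exists (fun=> 0); rewrite big_nil big1 // => i _; rewrite mul0r.
have [y ys|a Ea] := IH; first by apply: As; rewrite inE ys orbT.
have [i Pi Ei] := As x (mem_head _ _).
exists (fun j => (if j == i then x.1 else 0) + a j).
rewrite big_cons Ea Ei.
under [RHS]eq_bigr do rewrite mulrDl.
rewrite big_split /=; congr (_ + _).
by rewrite (bigD1 i) //= eqxx big1 ?addr0 // => j /andP[_ /negPf->]; rewrite mul0r.
Qed.

Lemma seq_idealP (R : comNzRingType) (fs : seq R) p :
  seq_ideal fs p <->
  exists a : 'I_(size fs) -> R, p = \sum_(i < size fs) a i * fs`_i.
Proof.
rewrite -(ideal_gen_finP xpredT (fun i : 'I_(size fs) => fs`_i) p).
apply: ideal_gen_ext => f; split=> [fs_f|[i _ ->]]; last exact: mem_nth.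
have lt_f: (index f fs < size fs)%N by rewrite index_mem.
by exists (Ordinal lt_f); rewrite ?nth_index.
Qed.

(** All syzygies are generated by the Koszul relations, whose coefficients lie in
    the ideal.  For the coefficients alone an induction suffices: the last one
    lies in the ideal of the earlier elements by regularity, and
    substituting its expression gives a shorter syzygy. *)
Lemma regular_syzygy (R : comNzRingType) (fs : seq R) :
  regular_sequence fs ->
  forall j (a : nat -> R), (j <= size fs)%N ->
    \sum_(i < j) a i * fs`_i = 0 ->
  forall i, (i < j)%N -> seq_ideal (take j fs) (a i).
Proof.
move=> [reg _]; elim=> [//|j IH] a lt_j.
rewrite big_ord_recr /= => syz.
have sub p : seq_ideal (take j fs) p -> seq_ideal (take j.+1 fs) p.
  apply: ideal_gen_min => f f_j; apply: ideal_gen_mem.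
  by rewrite (take_nth 0) // mem_rcons inE f_j orbT.
have sz_j : size (take j fs) = j by rewrite size_takel // ltnW.
have : seq_ideal (take j fs) (a j).
  apply: reg => //; move/eqP: syz; rewrite addr_eq0 -eqr_oppLR => /eqP <-.
  rewrite -mulN1r; apply/ideal_genMl/ideal_gen_sum => i _; apply/ideal_genMl.
  by apply: ideal_gen_mem; rewrite -(nth_take 0 (ltn_ord i)) mem_nth ?sz_j.
move=> aj i; rewrite ltnS leq_eqVlt => /predU1P[->|lt_ij]; first exact: sub.
have [b Eb] := (seq_idealP _ _).1 aj.
pose b' l := if insub l is Some l' then b l' else 0.
have Eb' : a j = \sum_(l < j) b' l * fs`_l.
  rewrite Eb -[in RHS]sz_j; apply: eq_bigr => l _.
  have lt_lj: (l < j)%N := leq_trans (ltn_ord l) (eq_leq sz_j).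
  by rewrite /b' valK nth_take.
have : seq_ideal (take j fs) (a i + b' i * fs`_j).
  apply: (IH (fun l => a l + b' l * fs`_j)) => //; first exact: ltnW.
  under eq_bigr do rewrite mulrDl mulrAC.
  by rewrite big_split /= -mulr_suml -Eb'.
move=> /sub abi; rewrite -[a i](addrK (b' i * fs`_j)) -mulNr.
apply: ideal_genD abi _; apply/ideal_genMl/ideal_gen_mem.
by rewrite (take_nth 0) // mem_rcons mem_head.
Qed.

Lemma monomial_ideal_genP (k : fieldType) n (P : 'X_{1..n} -> Prop)
    (p : {mpoly k[n]}) :
  ideal_gen (fun f => exists2 u, P u & f = 'X_[u]) p <->
  forall m, m \in msupp p -> exists2 u, P u & (u <= m)%MM.
Proof.
split=> [[s [As ->]] m /msupp_sum_le /flattenP[ms /mapP[x]]|Pm].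
  rewrite mem_filter /= => /As[u Pu ->] ->; rewrite (perm_mem (msuppMX _ _)).
  by case/mapP=> m' _ ->; exists u; rewrite ?lem_addr.
rewrite [p]mpolyE big_seq; apply: ideal_gen_sum => m /Pm[u Pu le_um].
rewrite -(submK le_um) mpolyXD scalerAl; apply/ideal_genMl/ideal_gen_mem.
by exists u.
Qed.

Lemma mesym1_le n (S : {set 'I_n}) (m : 'X_{1..n}) :
  (mesym1 S <= m)%MM = (S \subset supp m).
Proof.
apply/mnm_lepP/subsetP => Sm i => [iS|].
  by have := Sm i; rewrite mnmE iS inE.
by rewrite mnmE; case: (boolP (i \in S)) => // /Sm; rewrite inE.
Qed.

Lemma supp_mesym1 n (S : {set 'I_n}) : supp (mesym1 S) = S.
Proof. by apply/setP=> i; rewrite inE mnmE; case: (i \in S). Qed.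

Lemma prod_varE (k : fieldType) n (S : {set 'I_n}) :
  \prod_(i in S) 'X_i = 'X_[mesym1 S] :> {mpoly k[n]}.
Proof.
rewrite mprodXE; congr ('X_[_]); apply/mnmP=> j; rewrite mnm_sumE mnmE.
have [jS|jS] := boolP (j \in S).
  rewrite (bigD1 j) //= mnm1E eqxx big1 // => i /andP[_ /negPf ij].
  by rewrite mnm1E ij.
by rewrite big1 // => i iS; rewrite mnm1E; case: eqP iS jS => // -> ->.
Qed.

(** * Minimal non-faces and the Stanley-Reisner ideal *)

(** The supports of the minimal monomial generators, see
    [supports_min_generators]. *)
Definition min_nonfaces n (D : {set {set 'I_n}}) : {set {set 'I_n}} :=
  [set S | minset (fun F => F \notin D) S].

Lemma min_nonfaceN n (D : {set {set 'I_n}}) S : S \in min_nonfaces D -> S \notin D.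
Proof. by rewrite inE => /minsetp. Qed.

Lemma min_nonface_min n (D : {set {set 'I_n}}) (S T : {set 'I_n}) :
  S \in min_nonfaces D -> T \notin D -> T \subset S -> T = S.
Proof. by rewrite inE => /minsetinf; apply. Qed.

Lemma min_nonfacesP n (D : {set {set 'I_n}}) (F : {set 'I_n}) :
  F \notin D -> exists2 S, S \in min_nonfaces D & S \subset F.
Proof.
by move/(minset_exists (P := fun F => F \notin D)) => [S]; exists S; rewrite ?inE.
Qed.

Lemma nonfaceW n (D : {set {set 'I_n}}) (F G : {set 'I_n}) :
  simplicial_complex D -> F \notin D -> F \subset G -> G \notin D.
Proof. by move=> [_ hD] FD FG; apply: contra FD => /hD; apply. Qed.

Lemma SR_idealP (k : fieldType) n (D : {set {set 'I_n}}) (p : {mpoly k[n]}) :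
  simplicial_complex D ->
  SR_ideal D p <-> forall m, m \in msupp p -> supp m \notin D.
Proof.
move=> hD.
pose P u := exists2 F : {set 'I_n}, F \notin D & u = mesym1 F.
have -> : SR_ideal D p <-> ideal_gen (fun f => exists2 u, P u & f = 'X_[u]) p.
  apply: ideal_gen_ext => f; split=> [[F FD ->]|[_ [F FD ->] ->]].
    by exists (mesym1 F); [exists F | rewrite prod_varE].
  by exists F; rewrite ?prod_varE.
rewrite monomial_ideal_genP; split=> Dp m /Dp => [[_ [F FD ->]]|mD].
  by rewrite mesym1_le; apply: nonfaceW.
exists (mesym1 (supp m)); first by exists (supp m).
by rewrite mesym1_le.
Qed.

Lemma SR_ideal_minP (k : fieldType) n (D : {set {set 'I_n}}) (p : {mpoly k[n]}) :
  simplicial_complex D ->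
  SR_ideal D p <->
  ideal_gen (fun f => exists2 S, S \in min_nonfaces D & f = 'X_[mesym1 S]) p.
Proof.
move=> hD; rewrite SR_idealP //.
pose P u := exists2 F : {set 'I_n}, F \in min_nonfaces D & u = mesym1 F.
have -> : ideal_gen (fun f => exists2 S, S \in min_nonfaces D & f = 'X_[mesym1 S]) p
   <-> ideal_gen (fun f => exists2 u, P u & f = 'X_[u]) p.
  apply: ideal_gen_ext => f; split=> [[F FD ->]|[_ [F FD ->] ->]].
    by exists (mesym1 F); [exists F |].
  by exists F.
rewrite monomial_ideal_genP; split=> Dp m /Dp => [|[_ [S SD ->]]].
  move=> /min_nonfacesP[S SD Sm]; exists (mesym1 S); first by exists S.
  by rewrite mesym1_le.
by rewrite mesym1_le; apply: nonfaceW => //; apply: min_nonfaceN.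
Qed.

Lemma SR_ideal_mnm (k : fieldType) n (D : {set {set 'I_n}}) m :
  simplicial_complex D -> @SR_ideal k n D 'X_[m] <-> supp m \notin D.
Proof.
move=> hD; rewrite SR_idealP //; split=> [->//|mD u].
  by rewrite msuppX inE.
by rewrite msuppX inE => /eqP->.
Qed.

(** Every minimal non-face S forces the generator X^S into G, because a
    generator dividing X^S has a non-face inside S as its support.  These
    generators already suffice, so minimality of G excludes all others. *)
Lemma supports_min_generators (k : fieldType) n (D : {set {set 'I_n}}) G :
  simplicial_complex D -> minimal_monomial_generators (@SR_ideal k n D) G ->
  supports G = min_nonfaces D.
Proof.
move=> hD [_ GD minG].
have GP p : monomial_ideal G p <->
    forall m, m \in msupp p -> exists2 u, u \in G & (u <= m)%MM.
  rewrite -monomial_ideal_genP; apply: ideal_gen_ext => f.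
  by split=> [/mapP|[u uG ->]]; last exact: map_f.
have GN u : u \in G -> supp u \notin D.
  move=> uG; rewrite -(SR_ideal_mnm k) // GD GP => m.
  by rewrite msuppX inE => /eqP->; exists u; rewrite ?lepm_refl.
have minN S : S \in min_nonfaces D -> mesym1 S \in G.
  move=> SD; have := min_nonfaceN SD; rewrite -{1}(supp_mesym1 S).
  rewrite -(SR_ideal_mnm k) // GD GP => /(_ (mesym1 S)).
  rewrite msuppX mem_head => -[//|u uG le_uS].
  suff <- : u = mesym1 S by [].
  have uS : supp u = S.
    apply: min_nonface_min (GN _ uG) _ => //; apply/subsetP=> i.
    rewrite inE => u_i; move/mnm_lepP/(_ i): le_uS; rewrite mnmE.
    by case: (i \in S) => //; rewrite leqNgt u_i.
  apply/mnmP=> i; apply/eqP; rewrite eqn_leq (mnm_lepP le_uS) /=.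
  by move: i; apply/mnm_lepP; rewrite mesym1_le uS.
apply/setP=> S; rewrite inE; apply/mapP/idP => [[u uG ->]|/minN SG]; last first.
  by exists (mesym1 S); rewrite ?supp_mesym1.
pose G' := [seq mesym1 T | T <- enum (min_nonfaces D)].
have sG' : {subset G' <= G}.
  by move=> u' /mapP[T]; rewrite mem_enum => /minN ? ->.
have eqG' p : SR_ideal D p <-> @monomial_ideal k n G' p.
  rewrite SR_ideal_minP //; apply: ideal_gen_ext => f; split.
    by move=> [T TD ->]; rewrite !map_f ?mem_enum.
  by move=> /mapP[_ /mapP[T TD ->] ->]; exists T; first by rewrite -mem_enum.
have /mapP[T] := minG _ sG' eqG' _ uG.
by rewrite mem_enum => TD ->; rewrite supp_mesym1.
Qed.

Lemma mcoeffMX_eq0 (k : fieldType) n (p : {mpoly k[n]}) u m :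
  ~~ (u <= m)%MM -> (p * 'X_[u])@_m = 0.
Proof.
apply: contraNeq; rewrite -mcoeff_msupp (perm_mem (msuppMX _ _)).
by case/mapP=> m' _ ->; apply: lem_addr.
Qed.

Lemma min_nonface_neq0 n (D : {set {set 'I_n}}) (S : {set 'I_n}) :
  simplicial_complex D -> S \in min_nonfaces D -> S != set0.
Proof. by move=> [D0 _] /min_nonfaceN; apply: contraNneq => ->. Qed.

(** For pairwise coprime monomials, dividing X^U * X^m by an earlier generator
    never uses the factor X^U, so multiplication by X^U is injective modulo the
    earlier generators. *)
Lemma trivIset_complete_intersection (k : fieldType) n (D : {set {set 'I_n}}) :
  simplicial_complex D -> trivIset (min_nonfaces D) -> complete_intersection k D.
Proof.
move=> hD /trivIsetP triv.
pose mon (T : {set 'I_n}) : {mpoly k[n]} := 'X_[mesym1 T].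
have monP (Ts : seq {set 'I_n}) p : seq_ideal [seq mon T | T <- Ts] p <->
    forall m, m \in msupp p -> exists2 T, T \in Ts & T \subset supp m.
  pose P u := exists2 T : {set 'I_n}, T \in Ts & u = mesym1 T.
  transitivity (ideal_gen (fun f => exists2 u, P u & f = 'X_[u]) p).
    apply: ideal_gen_ext => f; split=> [/mapP[T TTs ->]|[_ [T TTs ->] ->]].
      by exists (mesym1 T); [exists T |].
    exact: map_f.
  rewrite monomial_ideal_genP; split=> Tp m /Tp => [[_ [T TTs ->]]|[T TTs Tm]].
    by rewrite mesym1_le; exists T.
  by exists (mesym1 T); [exists T | rewrite mesym1_le].
pose Ts := enum (min_nonfaces D).
exists [seq mon T | T <- Ts]; last first.
  move=> p; rewrite SR_ideal_minP //; apply: ideal_gen_ext => f.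
  split=> [[T TD ->]|/mapP[T TD ->]]; first by rewrite (map_f mon) ?mem_enum.
  by exists T; first by rewrite -mem_enum.
split=> [j p|]; last first.
  move/monP/(_ 0%MM); rewrite msupp1 mem_head => -[//|T].
  rewrite mem_enum => TD; apply/negP; have [i iT] := set0Pn _ (min_nonface_neq0 hD TD).
  by apply/subsetPn; exists i; rewrite // inE mnm0E.
rewrite size_map => lt_j; rewrite -map_take (nth_map set0) //.
set U := nth _ _ _ => /monP pU; apply/monP => m m_p.
have [|T TTs TUm] := pU (mesym1 U + m)%MM.
  by rewrite (perm_mem (msuppMX _ _)) map_f.
exists T => //; apply/subsetP=> i iT; move/subsetP/(_ i iT): TUm.
rewrite !inE mnmDE mnmE.
suff /disjointFr->: [disjoint T & U] by [].
have UD : U \in min_nonfaces D by rewrite -mem_enum mem_nth.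
have TD : T \in min_nonfaces D by rewrite -mem_enum (mem_take TTs).
apply: triv => //; apply: contraTneq TTs => ->.
by rewrite in_take_leq ?index_uniq ?enum_uniq ?ltnn // ltnW.
Qed.

(** The syzygy argument described at the top; [c a] is the row vector a B. *)
Lemma complete_intersection_trivIset (k : fieldType) n (D : {set {set 'I_n}}) :
  simplicial_complex D -> complete_intersection k D -> trivIset (min_nonfaces D).
Proof.
move=> hD [fs reg fsD].
pose mon (T : {set 'I_n}) : {mpoly k[n]} := 'X_[mesym1 T].
pose r := size fs.
have f_D (j : 'I_r) : exists b : {ffun {set 'I_n} -> {mpoly k[n]}},
    fs`_j = \sum_(S in min_nonfaces D) b S * mon S.
  have : SR_ideal D fs`_j by rewrite fsD; apply: ideal_gen_mem; apply: mem_nth.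
  rewrite SR_ideal_minP // (ideal_gen_finP (mem (min_nonfaces D)) mon) => -[b Eb].
  by exists [ffun S => b S]; rewrite Eb; apply: eq_bigr => S _; rewrite ffunE.
have mon_f S : S \in min_nonfaces D -> exists a : 'I_r -> {mpoly k[n]},
    mon S = \sum_(j < r) a j * fs`_j.
  move=> SD; apply/seq_idealP/fsD/SR_ideal_mnm => //.
  by rewrite supp_mesym1 min_nonfaceN.
have [b Eb] := fin_all_exists f_D.
apply/trivIsetP => S T SD TD neST; apply/negPn/negP => meetST.
have [aS EaS] := mon_f S SD; have [aT EaT] := mon_f T TD.
pose c (a : 'I_r -> {mpoly k[n]}) U := \sum_(j < r) a j * b j U.
have cE (a : 'I_r -> {mpoly k[n]}) :
    \sum_(j < r) a j * fs`_j = \sum_(U in min_nonfaces D) c a U * mon U.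
  under eq_bigr do rewrite Eb mulr_sumr.
  rewrite exchange_big; apply: eq_bigr => U _; rewrite mulr_suml.
  by apply: eq_bigr => j _; rewrite mulrA.
(* no other minimal generator divides X^S, so only the diagonal entry counts *)
have c1 : (c aS S)@_0%MM = 1.
  have : (mon S)@_(mesym1 S) = 1 by rewrite mcoeffX eqxx.
  rewrite EaS cE (bigD1 S) //= mcoeffD raddf_sum /= big1 ?addr0 => [|U].
    by rewrite -[X in _@_X]addm0 mcoeffMX.
  case/andP=> UD neUS; apply: mcoeffMX_eq0; rewrite mesym1_le supp_mesym1.
  by apply: contraNN neUS => US; rewrite (min_nonface_min SD _ US) // min_nonfaceN.
pose m1 := mesym1 (T :\: S); pose m2 := mesym1 (S :\: T).
pose a (j : nat) := if insub j is Some j' then aS j' * 'X_[m1] - aT j' * 'X_[m2] else 0.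
have aE (j : 'I_r) : a j = aS j * 'X_[m1] - aT j * 'X_[m2] by rewrite /a valK.
have syz : \sum_(j < r) a j * fs`_j = 0.
  under eq_bigr do rewrite aE mulrBl mulrAC [aT _ * _ * _]mulrAC.
  rewrite sumrB -!mulr_suml -EaS -EaT -!mpolyXD; apply/eqP; rewrite subr_eq0.
  apply/eqP; congr ('X_[_]); apply/mnmP => i; rewrite !mnmE !inE.
  by case: (i \in S); case: (i \in T).
have aD (j : 'I_r) : SR_ideal D (a j).
  by rewrite fsD -[fs]take_size; apply: (regular_syzygy reg (leqnn _) syz).
have : SR_ideal D (c a S).
  by apply: ideal_gen_sum => j _; rewrite mulrC; apply: ideal_genMl (aD j).
have -> : c a S = c aS S * 'X_[m1] - c aT S * 'X_[m2].
  rewrite /c !mulr_suml -sumrB; apply: eq_bigr => j _.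
  by rewrite aE mulrBl mulrAC [aT _ * _ * _]mulrAC.
rewrite SR_idealP // => /(_ m1); rewrite mcoeff_msupp mcoeffB.
rewrite -{1}[m1]addm0 mcoeffMX c1 mcoeffMX_eq0 ?subr0 ?oner_eq0 => [/(_ isT)|].
  rewrite supp_mesym1 => /(min_nonface_min TD)/(_ (subsetDl _ _))/setDidPl.
  by rewrite disjoint_sym (negPf meetST).
(* X^(S - T) divides X^(T - S) only if S is contained in T *)
rewrite mesym1_le supp_mesym1; apply/negP => sub.
have S0 : S :\: T = set0.
  apply/eqP; rewrite -subset0 -(setICr T) subsetI {2}setDE subsetIr andbT.
  exact: subset_trans sub (subsetDl _ _).
case/eqP: neST; apply: (min_nonface_min TD (min_nonfaceN SD)).
by rewrite -setD_eq0 S0.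
Qed.

Local Close Scope ring_scope.

(** * Minimal non-faces of links *)

Definition vertex_complex n (D : {set {set 'I_n}}) : Prop :=
  simplicial_complex D /\ forall i : 'I_n, [set i] \in D.

Lemma min_nonface_antichain n (D : {set {set 'I_n}}) (S T : {set 'I_n}) :
  S \in min_nonfaces D -> T \in min_nonfaces D -> S \subset T -> S = T.
Proof. by move=> /min_nonfaceN SD TD; apply: (min_nonface_min TD SD). Qed.

Lemma min_nonface_card n (D : {set {set 'I_n}}) (S : {set 'I_n}) :
  vertex_complex D -> S \in min_nonfaces D -> 2 <= #|S|.
Proof.
move=> [hD hv] SD; rewrite ltn_neqAle eq_sym card_gt0 (min_nonface_neq0 hD SD).
rewrite andbT; apply/negP=> /cards1P[i Si].
by have := min_nonfaceN SD; rewrite Si hv.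
Qed.

Lemma min_nonface_other n (D : {set {set 'I_n}}) (S : {set 'I_n}) (i : 'I_n) :
  vertex_complex D -> S \in min_nonfaces D -> exists2 j, j \in S & j != i.
Proof.
move=> hD /(min_nonface_card hD)/card_gt1P[a [b [aS bS neab]]].
have [Ea|] := eqVneq a i; last by exists a.
by exists b; rewrite // -Ea eq_sym.
Qed.

Lemma edge_neq n (D : {set {set 'I_n}}) (i j : 'I_n) :
  vertex_complex D -> [set i; j] \in min_nonfaces D -> i != j.
Proof. by move=> hD /(min_nonface_card hD); rewrite cards2; case: eqP. Qed.

Lemma min_nonface_edge n (D : {set {set 'I_n}}) (S : {set 'I_n}) :
  vertex_complex D -> S \in min_nonfaces D -> ~~ (3 <= #|S|) ->
  exists a b, S = [set a; b].
Proof.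
move=> hD /(min_nonface_card hD) S2; rewrite -ltnNge ltnS => S2'.
have /cards2P[a [b [_ ->]]] : #|S| == 2 by rewrite eqn_leq S2'.
by exists a, b.
Qed.

Lemma set2_eq_of (T : finType) (A : {set T}) (a b : T) :
  a \in A -> b \in A -> A \subset [set a; b] -> A = [set a; b].
Proof.
by move=> aA bA sub; apply/eqP; rewrite eqEsubset sub subUset !sub1set aA.
Qed.

Lemma edge_sub_big n (D : {set {set 'I_n}}) (S : {set 'I_n}) (i j : 'I_n) :
  S \in min_nonfaces D -> 3 <= #|S| -> i \in S -> j \in S ->
  [set i; j] \notin min_nonfaces D.
Proof.
move=> SD S3 iS jS; apply: contraL S3 => ijD.
rewrite -(min_nonface_antichain ijD SD) ?subUset ?sub1set ?iS //.
by rewrite cards2; case: (_ == _).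
Qed.

Lemma linkE n (D : {set {set 'I_n}}) (i : 'I_n) (X : {set 'I_n}) :
  (X \in link D [set i]) = (i \notin X) && (i |: X \in D).
Proof.
by rewrite inE setUC setI_eq0 disjoint_sym disjoints1 andbC.
Qed.

Lemma simplicial_link n (D : {set {set 'I_n}}) (i : 'I_n) :
  vertex_complex D -> simplicial_complex (link D [set i]).
Proof.
move=> [[D0 hD] hv]; split=> [|F G]; rewrite !linkE; first by rewrite inE setU0 hv.
case/andP=> iF FD GF; rewrite (contraNN _ iF) ?(hD _ _ FD) ?setUS //.
exact: (subsetP GF).
Qed.

Lemma min_nonface_link_del n (D : {set {set 'I_n}}) (i : 'I_n) (S : {set 'I_n}) :
  S \in min_nonfaces D -> i \in S ->
  S :\ i \in min_nonfaces (link D [set i]).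
Proof.
move=> SD iS; rewrite inE; apply/minsetP; split=> [|X].
  by rewrite linkE setD1K // (negPf (min_nonfaceN SD)) andbF.
rewrite linkE negb_and negbK => XN XS.
have iX : i \notin X by apply/negP=> /(subsetP XS); rewrite !inE eqxx.
move: XN; rewrite (negPf iX) => XD.
rewrite -(min_nonface_min SD XD) ?setU1K //.
by rewrite subUset sub1set iS (subset_trans XS) ?subsetDl.
Qed.

(** A minimal non-face of D avoiding i stops being minimal in the link of i only
    when the trace of some minimal non-face through i fits inside it. *)
Lemma min_nonface_link n (D : {set {set 'I_n}}) (i : 'I_n) (S : {set 'I_n}) :
  simplicial_complex D ->
  S \in min_nonfaces D -> i \notin S ->
  (forall T : {set 'I_n}, T \in min_nonfaces D -> i \in T ->
     ~~ (T :\ i \subset S)) ->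
  S \in min_nonfaces (link D [set i]).
Proof.
move=> hD SD iS minS; rewrite inE; apply/minsetP; split=> [|X].
  rewrite linkE iS; apply: (nonfaceW hD (min_nonfaceN SD)); exact: subsetUr.
rewrite linkE negb_and negbK => XN XS.
have iX : i \notin X by apply: contraNN iS; apply: (subsetP XS).
move: XN; rewrite (negPf iX) => /min_nonfacesP[T TD TX].
have [iT|iT] := boolP (i \in T).
  case/negP: (minS T TD iT); rewrite subDset; apply: subset_trans TX _.
  by rewrite setUS.
have TX' : T \subset X.
  by apply/subsetP=> x xT; have := subsetP TX x xT; rewrite !inE;
    case: eqP xT iT => // -> ->.
apply/eqP; rewrite eqEsubset XS -(min_nonface_antichain TD SD) //.
exact: subset_trans XS.
Qed.

Lemma min_nonface_linkP n (D : {set {set 'I_n}}) (i : 'I_n) (X : {set 'I_n}) :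
  simplicial_complex D -> X \in min_nonfaces (link D [set i]) -> X != [set i] ->
  [/\ i \notin X, exists2 S, S \in min_nonfaces D & X = S :\ i &
      forall S, S \in min_nonfaces D -> S :\ i \subset X -> S :\ i = X].
Proof.
move=> hD XL neX.
have iX : i \notin X.
  apply: contraNN neX => iX; rewrite -(min_nonface_min XL (T := [set i])) ?sub1set //.
  by rewrite (linkE D i [set i]) set11.
have minX (S : {set 'I_n}) : S \in min_nonfaces D -> S :\ i \subset X -> S :\ i = X.
  move=> SD; apply: (min_nonface_min XL); rewrite linkE !inE eqxx /=.
  by apply: (nonfaceW hD (min_nonfaceN SD)); apply/subsetP=> x xS; rewrite !inE xS andbT orbN.
split=> //; have := min_nonfaceN XL; rewrite linkE iX => /min_nonfacesP[S SD SX].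
by exists S; rewrite // minX // subDset.
Qed.

(** * Consequences of disjointness in all links *)

Lemma disjoint_mem (T : finType) (A B : {set T}) (x : T) :
  [disjoint A & B] -> x \in A -> x \in B -> False.
Proof. by move=> dAB xA xB; rewrite (disjointFr dAB xA) in xB. Qed.

(** The combinatorial form of: all links of vertices are complete
    intersections. *)
Definition links_disjoint n (D : {set {set 'I_n}}) : Prop :=
  forall i : 'I_n, trivIset (min_nonfaces (link D [set i])).

(** Inside the link of a common vertex i, the traces S - i and T - i are both
    minimal, hence disjoint. *)
Lemma links_meet_le1 n (D : {set {set 'I_n}}) (S T : {set 'I_n}) (i x : 'I_n) :
  links_disjoint D -> S \in min_nonfaces D -> T \in min_nonfaces D -> S != T ->
  i \in S -> i \in T -> x \in S -> x \in T -> x = i.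
Proof.
move=> H SD TD neST iS iT xS xT; apply/eqP/negPn/negP => nex.
have ne : S :\ i != T :\ i.
  by apply: contra neST => /eqP E; rewrite -(setD1K iS) E setD1K.
have /trivIsetP/(_ _ _ (min_nonface_link_del SD iS) (min_nonface_link_del TD iT) ne) := H i.
by move=> /(@disjoint_mem _ _ _ x); rewrite !inE nex xS xT; apply.
Qed.

(** T cannot be minimal in the link of i together with S (or its trace), since
    they meet at x; the witness U records which of the two is not minimal. *)
Lemma links_meet_outside n (D : {set {set 'I_n}}) (S T : {set 'I_n}) (i x : 'I_n) :
  vertex_complex D -> links_disjoint D ->
  S \in min_nonfaces D -> T \in min_nonfaces D -> S != T ->
  i \notin T -> x \in S -> x \in T ->
  exists U : {set 'I_n}, [/\ U \in min_nonfaces D, i \in U &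
    (U :\ i \subset T) || (i \notin S) && (U :\ i \subset S)].
Proof.
move=> hD H SD TD neST iT xS xT.
have nex : x != i by apply: contraNneq iT => <-.
have hD' := hD.1.
case: (boolP [exists U : {set 'I_n}, [&& U \in min_nonfaces D, i \in U &
    (U :\ i \subset T) || (i \notin S) && (U :\ i \subset S)]]) => [/existsP[U /and3P[]]|].
  by exists U.
move/existsPn => noU; exfalso.
have TL : T \in min_nonfaces (link D [set i]).
  apply: min_nonface_link => // U UD iU; apply: contraNN (noU U) => UT.
  by rewrite UD iU UT.
have disj : forall S', S' \in min_nonfaces (link D [set i]) -> S' != T ->
    x \in S' -> False.
  move=> S' SL ne xS'; have /trivIsetP/(_ _ _ SL TL ne) := H i.
  by move/disjoint_mem/(_ xS'); apply.
have [iS|iS] := boolP (i \in S).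
  apply: (disj _ (min_nonface_link_del SD iS)); last by rewrite !inE nex.
  apply: contraNneq neST => E; rewrite eq_sym; apply/eqP.
  by apply: (min_nonface_antichain TD SD); rewrite -E subsetDl.
apply: (disj S) => //; apply: min_nonface_link => // U UD iU.
by apply: contraNN (noU U) => US; rewrite UD iU US iS orbT.
Qed.

(** The source of the cone set C(S): a minimal non-face S with three or
    more vertices meets the others only in edges, and each such edge {i, t}
    comes with the whole cone of edges from t to S.  Looking at S and T from
    the link of another vertex j of S produces the edge {j, t} with t in T;
    looking at S and {j, t} from the link of i then shows that T = {i, t}. *)
Lemma links_meet_big n (D : {set {set 'I_n}}) (S T : {set 'I_n}) (i : 'I_n) :
  vertex_complex D -> links_disjoint D ->
  S \in min_nonfaces D -> 3 <= #|S| -> T \in min_nonfaces D -> T != S ->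
  i \in S -> i \in T ->
  exists t, [/\ t \notin S, T = [set i; t] &
    forall j, j \in S -> [set j; t] \in min_nonfaces D].
Proof.
move=> hD H SD S3 TD neTS iS iT.
have neST : S != T by rewrite eq_sym.
have edge j : j \in S -> j != i ->
    exists t, [/\ t \notin S, T = [set i; t] & [set j; t] \in min_nonfaces D].
  move=> jS neji.
  have jT : j \notin T.
    by apply: contraNN neji => jT; apply/eqP; apply: (links_meet_le1 H SD TD).
  have [U [UD jU]] := links_meet_outside hD H SD TD neST jT iS iT.
  rewrite jS /= orbF => UT.
  have neUT : U != T by apply: contraNneq jT => <-.
  have [t tU netj] := min_nonface_other j hD UD.
  have subT x : x \in U -> x != j -> x \in T.
    by move=> xU nex; apply: (subsetP UT); rewrite !inE nex.
  have tT := subT t tU netj.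
  have EU : U = [set j; t].
    apply: set2_eq_of => //; apply/subsetP=> x xU; rewrite !inE.
    have [//|nexj] := eqVneq x j.
    by rewrite (links_meet_le1 H UD TD neUT tU tT xU (subT x xU nexj)) eqxx.
  have jtD : [set j; t] \in min_nonfaces D by rewrite -EU.
  have tS : t \notin S.
    apply/negP => tS; by rewrite (negPf (edge_sub_big SD S3 jS tS)) in jtD.
  exists t; split=> //.
  have neti : t != i by apply: contraNneq tS => ->.
  have ijt : i \notin [set j; t] by rewrite !inE (eq_sym i j) (eq_sym i t) negb_or neji.
  have neSU : S != [set j; t] by apply: contraNneq ijt => <-.
  have [V [VD iV]] := links_meet_outside hD H SD jtD neSU ijt jS (set21 j t).
  rewrite iS /= orbF => sV.
  have subV x : x \in V -> x != i -> (x == j) || (x == t).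
    by move=> xV nex; have := subsetP sV x; rewrite !inE xV nex; apply.
  have [v vV nevi] := min_nonface_other i hD VD.
  case/orP: (subV v vV nevi) => /eqP Ev; rewrite {v}Ev in vV nevi.
    have EVS : V = S.
      apply/eqP/negPn/negP => neVS.
      by rewrite (links_meet_le1 H VD SD neVS iV iS vV jS) eqxx in nevi.
    move: S3; rewrite -EVS (_ : V = [set i; j]) ?cards2; first by case: (_ != _).
    apply: set2_eq_of => //; apply/subsetP=> x xV; rewrite !inE.
    have [//|nex] := eqVneq x i; case/orP: (subV x xV nex) => // /eqP Ex.
    by rewrite -EVS -Ex xV in tS.
  have EVT : V = T.
    apply/eqP/negPn/negP => neVT.
    by rewrite (links_meet_le1 H VD TD neVT iV iT vV tT) eqxx in nevi.
  apply: set2_eq_of => //; apply/subsetP=> x xT; rewrite !inE.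
  have [//|nex] := eqVneq x i; rewrite -EVT in xT.
  by case/orP: (subV x xT nex) => // /eqP Ex; rewrite -Ex -EVT xT in jT.
have [j jS neji] := min_nonface_other i hD SD.
have [t [tS ET _]] := edge j jS neji; exists t; split=> // l lS.
have [->|neli] := eqVneq l i; first by rewrite -ET.
have [t' [t'S ET' lt']] := edge l lS neli.
suff <- : t' = t by [].
have : t' \in T by rewrite ET' set22.
by rewrite ET !inE => /orP[] /eqP // E; rewrite -E (negPf t'S) in iS.
Qed.

Lemma meeting_min_nonfaces n (D : {set {set 'I_n}}) :
  ~~ trivIset (min_nonfaces D) ->
  exists (S T : {set 'I_n}) (x : 'I_n),
    [/\ S \in min_nonfaces D, T \in min_nonfaces D, S != T, x \in S & x \in T].
Proof.
move=> nt; case: (boolP [exists S in min_nonfaces D, [exists T in min_nonfaces D,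
    (S != T) && ~~ [disjoint S & T]]]).
  case/exists_inP=> S SD /exists_inP[T TD /andP[neST]].
  rewrite -setI_eq0 => /set0Pn[x /setIP[xS xT]].
  by exists S, T, x.
move/exists_inPn=> dis; case/trivIsetP: nt => S T SD TD neST.
by move: (dis S SD) => /exists_inPn/(_ T TD); rewrite neST negbK.
Qed.

(** Deleting i from a minimal non-face gives a face whose union with i is not a
    face, so i is not a cone point; conversely a vertex in no minimal non-face
    can be added to every face. *)
Lemma core_verticesP n (D : {set {set 'I_n}}) (i : 'I_n) :
  simplicial_complex D ->
  reflect (exists2 S : {set 'I_n}, S \in min_nonfaces D & i \in S)
          (i \in core_vertices D).
Proof.
move=> hD; rewrite inE; apply: (iffP idP) => [neD|[S SD iS]].
  apply/exists_inP; apply: contraNT neD => /exists_inPn noS.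
  apply/eqP/setP=> X; rewrite inE.
  apply/idP/idP=> [XD|XD]; first by apply: hD.2 XD (subsetUl _ _).
  apply: contraTT XD => /min_nonfacesP[S SD SX].
  apply: (nonfaceW hD (min_nonfaceN SD)); apply/subsetP=> x xS.
  have := subsetP SX x xS; rewrite !inE => /orP[//|/eqP Ex].
  by have := noS S SD; rewrite -Ex xS.
apply: contraNneq (min_nonfaceN SD) => E.
have SiD : S :\ i \in D.
  apply: contraT => /(min_nonface_min SD)/(_ (subsetDl _ _)) Si.
  by move: iS; rewrite -Si !inE eqxx.
by rewrite -E inE setUC setD1K in SiD.
Qed.

Lemma core_fullP n (D : {set {set 'I_n}}) :
  vertex_complex D ->
  D = core D <-> forall i : 'I_n, exists2 S : {set 'I_n}, S \in min_nonfaces D & i \in S.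
Proof.
move=> [hD hv]; split=> [E i|full].
  apply/(core_verticesP _ hD); have : [set i] \in core D by rewrite -E hv.
  by case/imsetP=> F _ EF; have := set11 i; rewrite EF => /setIP[].
have coreT F : F :&: core_vertices D = F.
  by apply/setIidPl/subsetP=> i _; apply/(core_verticesP _ hD).
by rewrite /core; apply/setP=> F; apply/idP/imsetP=> [FD|[F' ? ->]];
  [exists F | ]; rewrite ?coreT.
Qed.

(** The set C(S) consists of the outer vertices adjacent to S.  It is non-empty
    because otherwise S is isolated, and the pair of minimal non-faces T, T'
    that meet would survive in the link of a vertex of S.  A vertex l
    outside C(S) and S sees S and the edge {j, i} meeting at j, and only an
    edge between i and l can resolve this in the link of l. *)
Lemma gci_isolating n (D : {set {set 'I_n}}) :
  vertex_complex D -> links_disjoint D ->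
  ~~ trivIset (min_nonfaces D) -> isolating_condition (min_nonfaces D).
Proof.
move=> hD H /meeting_min_nonfaces[T [T' [x [TD T'D neTT' xT xT']]]].
move=> S SD S3.
pose C := [set t | (t \notin S) && [exists i in S, [set i; t] \in min_nonfaces D]].
have edge t : t \in C -> forall j, j \in S -> [set j; t] \in min_nonfaces D.
  rewrite inE => /andP[tS /exists_inP[i iS itD]] j jS.
  have ne : [set i; t] != S by apply: contraNneq tS => <-; apply: set22.
  have [t' [t'S E /(_ j jS)]] := links_meet_big hD H SD S3 itD ne iS (set21 i t).
  suff -> : t' = t by [].
  have : t' \in [set i; t] by rewrite E set22.
  by rewrite !inE => /orP[] /eqP // E'; rewrite -E' (negPf t'S) in iS.
have meet U i : U \in min_nonfaces D -> U != S -> i \in S -> i \in U ->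
    exists2 t, t \in C & U = [set i; t].
  move=> UD neUS iS iU.
  have [t [tS E tedge]] := links_meet_big hD H SD S3 UD neUS iS iU.
  by exists t; rewrite // inE tS; apply/exists_inP; exists i => //; apply: tedge.
exists C; split.
- apply/negP=> /eqP C0.
  have far U i : U \in min_nonfaces D -> U != S -> i \in S -> i \notin U.
    move=> UD neUS iS; apply/negP=> iU; have [t] := meet U i UD neUS iS iU.
    by rewrite C0 inE.
  have [i iS] := set0Pn _ (min_nonface_neq0 hD.1 SD).
  have [j jS neji] := min_nonface_other i hD SD.
  have xS : x \notin S.
    have [ES|neTS] := eqVneq T S.
      by apply: contraTN xT' => xS; apply: far; rewrite // -ES eq_sym.
    by apply: contraTN xT => xS; apply: far.
  have neTS : T != S by apply: contraNneq xS => <-.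
  have neT'S : T' != S by apply: contraNneq xS => <-.
  have [U [UD iU]] := links_meet_outside hD H TD T'D neTT' (far _ _ T'D neT'S iS) xT xT'.
  have US : U = S by apply/eqP; apply: contraTT iU => ne; apply: far.
  rewrite US => /orP[|/andP[_]] /subsetP/(_ j); rewrite !inE neji jS => /(_ isT).
    by apply/negP; apply: far.
  by apply/negP; apply: far.
- by apply/setP=> t; rewrite !inE; case: (t \in S); rewrite ?andbF.
- split=> [i iC j jS|U UD neUS]; first by rewrite setUC; apply: edge.
  case/set0Pn=> j /setIP[jS jU]; have [t tC ->] := meet U j UD neUS jS jU.
  by exists t, j; rewrite setUC.
move=> l; rewrite inE negb_or => /andP[lC lS] i iC.
have [j jS] := set0Pn _ (min_nonface_neq0 hD.1 SD).
have ijD := edge i iC j jS.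
have iS : i \notin S by move: iC; rewrite inE => /andP[].
have neli : l != i by apply: contraNneq lC => ->.
have nelj : l != j by apply: contraNneq lS => ->.
have lij : l \notin [set j; i] by rewrite !inE negb_or nelj neli.
have ne : S != [set j; i] by apply: contraNneq iS => ->; apply: set22.
have [U [UD lU]] := links_meet_outside hD H SD ijD ne lij jS (set21 _ _).
have neUS : U != S by apply: contraNneq lS => <-.
have noj : j \notin U.
  apply/negP => jU; have [t tC E] := meet U j UD neUS jS jU.
  by move: lU; rewrite E !inE (negPf nelj) => /eqP El; rewrite El tC in lC.
have noS m : m \in S -> m \notin U.
  move=> mS; apply/negP => mU; have [t tC E] := meet U m UD neUS mS mU.
  have nelm : l != m by apply: contraNneq lS => ->.
  by move: lU; rewrite E !inE (negPf nelm) => /eqP El; rewrite El tC in lC.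
have [v vU nevl] := min_nonface_other l hD UD.
case/orP=> [sub|/andP[_ /subsetP/(_ v)]]; last first.
  by rewrite !inE nevl vU => /(_ isT) /noS; rewrite vU.
have Ui w : w \in U -> w != l -> w = i.
  move=> wU newl; have := subsetP sub w; rewrite !inE newl wU => /(_ isT).
  by case/orP=> /eqP // E; rewrite E (negPf noj) in wU.
have Ev := Ui v vU nevl; rewrite Ev in vU.
rewrite (_ : [set i; l] = U) //; apply/esym/set2_eq_of => //.
apply/subsetP=> w wU; rewrite !inE orbC; have [//|newl] := eqVneq w l.
by rewrite (Ui w wU newl) eqxx.
Qed.

Definition edge_rel n (D : {set {set 'I_n}}) : rel 'I_n :=
  fun i j => [set i; j] \in min_nonfaces D.

Lemma edge_rel_sym n (D : {set {set 'I_n}}) : symmetric (edge_rel D).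
Proof. by move=> i j; rewrite /edge_rel setUC. Qed.

Lemma isolating_connect n (D : {set {set 'I_n}}) (S : {set 'I_n}) (a b : 'I_n) :
  vertex_complex D -> isolating_condition (min_nonfaces D) ->
  S \in min_nonfaces D -> a \in S -> b \in S -> connect (edge_rel D) a b.
Proof.
move=> hD iso SD aS bS; have [S3|/(min_nonface_edge hD SD)[u [v ES]]] := boolP (3 <= #|S|).
  have [C [/set0Pn[t tC] _ [edge _] _]] := iso S SD S3.
  apply: (@connect_trans _ _ t); last by apply/connect1/edge.
  by rewrite connect1 // edge_rel_sym; apply: edge.
rewrite {}ES in SD aS bS; move: aS bS; rewrite !inE => /orP[]/eqP-> /orP[]/eqP->.
- exact: connect0.
- exact: connect1.
- by apply: connect1; rewrite edge_rel_sym.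
- exact: connect0.
Qed.

(** Two minimal non-faces that meet lie in one component; a vertex l outside
    this component could not separate them in its link. *)
Lemma gci_linked n (D : {set {set 'I_n}}) :
  vertex_complex D -> links_disjoint D -> ~~ trivIset (min_nonfaces D) ->
  isolating_condition (min_nonfaces D) -> linked_condition (min_nonfaces D).
Proof.
move=> hD H /meeting_min_nonfaces[S [T [x [SD TD neST xS xT]]]] iso.
have sym := sym_connect_sym (@edge_rel_sym _ D).
suff conn l : connect (edge_rel D) x l.
  move=> i j _; have /connectP[p pth lst] : connect (edge_rel D) i j.
    by apply: (@connect_trans _ _ x); rewrite // sym.
  by exists p.
have inS m : m \in S -> connect (edge_rel D) x m by apply: isolating_connect SD xS.
have inT m : m \in T -> connect (edge_rel D) x m by apply: isolating_connect TD xT.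
have [/inS//|lS] := boolP (l \in S); have [/inT//|lT] := boolP (l \in T).
have [U [UD lU sub]] := links_meet_outside hD H SD TD neST lT xS xT.
have [v vU nevl] := min_nonface_other l hD UD.
apply: (@connect_trans _ _ v); last exact: isolating_connect UD vU lU.
by case/orP: sub => [|/andP[_]] /subsetP/(_ v); rewrite !inE nevl vU => /(_ isT);
  [apply: inT | apply: inS].
Qed.

Lemma edge_of_link_sub n (D : {set {set 'I_n}}) (U : {set 'I_n}) (i a b : 'I_n) :
  vertex_complex D -> U \in min_nonfaces D -> [set a; b] \in min_nonfaces D ->
  i \in U -> i \notin [set a; b] -> U :\ i \subset [set a; b] ->
  [set i; a] \in min_nonfaces D \/ [set i; b] \in min_nonfaces D.
Proof.
move=> hD UD abD iU iab sub.
have [v vU nevi] := min_nonface_other i hD UD.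
have subU w : w \in U -> w != i -> (w == a) || (w == b).
  by move=> wU newi; have := subsetP sub w; rewrite !inE newi wU; apply.
have notboth : ~~ ((a \in U) && (b \in U)).
  apply: contraNN iab => /andP[aU bU].
  by rewrite (min_nonface_antichain abD UD) // subUset !sub1set aU.
have EU : U = [set i; v].
  apply: set2_eq_of => //; apply/subsetP => w wU; rewrite !inE.
  have [//|newi] := eqVneq w i; apply: contraR notboth => newv.
  have wab := subU w wU newi; have vab := subU v vU nevi.
  case/orP: wab newv wU => /eqP->; case/orP: vab vU => /eqP->;
    by rewrite ?eqxx // => -> _ ->.
by rewrite EU in UD; case/orP: (subU v vU nevi) => /eqP <-; [left|right].
Qed.

(** The edges {i3, i4} and {i4, i5} meet at i4, so they cannot both be minimal in
    the link of i1; the obstruction is a chord from i1. *)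
Lemma gci_length4 n (D : {set {set 'I_n}}) :
  vertex_complex D -> links_disjoint D -> length4_path_condition (min_nonfaces D).
Proof.
move=> hD H i1 i2 i3 i4 i5 e12 e23 e34 e45 uq.
have [E13|ne13] := eqVneq i1 i3.
  by move: uq; rewrite E13 setUC /= inE eqxx.
have [E14|ne14] := eqVneq i1 i4; first by constructor 1; rewrite E14 setUC.
have [E15|ne15] := eqVneq i1 i5; first by constructor 2; rewrite E15 setUC.
have ne : [set i3; i4] != [set i4; i5].
  by apply: contraTneq uq => ->; rewrite /= !inE !eqxx /= !andbF.
have n45 : i1 \notin [set i4; i5] by rewrite !inE negb_or ne14.
have n34 : i1 \notin [set i3; i4] by rewrite !inE negb_or ne13.
have [U [UD iU]] := links_meet_outside hD H e34 e45 ne n45 (set22 _ _) (set21 _ _).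
case/orP=> [|/andP[_]] sub.
  by have [] := edge_of_link_sub hD UD e45 iU n45 sub; [constructor 2|constructor 3].
by have [] := edge_of_link_sub hD UD e34 iU n34 sub; [constructor 1|constructor 2].
Qed.

(** A complete subgraph of the 1-skeleton containing no larger minimal non-face
    is the same thing as a face. *)
Lemma admissible_face n (D : {set {set 'I_n}}) (i : 'I_n) r H :
  vertex_complex D -> admissible_subgraph (min_nonfaces D) i r H ->
  [/\ vertices H \in D, i \in vertices H & #|vertices H| = r].
Proof.
move=> hD [[_ subE] [f [injf imf isof]] iH noS]; split=> //; last first.
  by rewrite -(card_in_imset injf) imf cardsT card_ord.
apply: contraT => /min_nonfacesP[S SD SH].
have [S3|/(min_nonface_edge hD SD)[a [b ES]]] := boolP (3 <= #|S|).
  by have := noS S SD S3; rewrite SH.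
rewrite {}ES in SD SH; have ab := edge_neq hD SD.
move: SH; rewrite subUset !sub1set => /andP[aH bH].
have : [set a; b] \in edges H.
  rewrite isof // inE cards2; suff -> : f a != f b by [].
  by apply: contraNneq ab => /injf->.
by move/(subsetP subE); rewrite inE SD andbF.
Qed.

Lemma face_edgesP n (A : {set 'I_n}) :
  [forall e in [set e : {set 'I_n} | (e \subset A) && (#|e| == 2)],
     (e \subset A) && (#|e| == 2)].
Proof. by apply/forall_inP => e; rewrite inE. Qed.

Lemma face_admissible n (D : {set {set 'I_n}}) (i : 'I_n) (A : {set 'I_n}) :
  simplicial_complex D -> A \in D -> i \in A ->
  admissible_subgraph (min_nonfaces D) i #|A| (Graph (face_edgesP A)).
Proof.
move=> hD AD iA.
have noS S : S \in min_nonfaces D -> ~~ (S \subset A).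
  by move/min_nonfaceN=> SN; apply: contraTN AD => SA; apply: nonfaceW hD SN SA.
split=> //=; last by move=> S SD _; apply: noS.
- split; rewrite /= ?subsetT //; apply/subsetP=> e; rewrite !inE => /andP[eA ->].
  by apply: contraTN eA => eD; apply: noS; rewrite inE.
- have inj : {in A &, injective (enum_rank_in iA)} by apply: can_in_inj (enum_rankK_in iA).
  exists (enum_rank_in iA); split=> //=.
    apply/setP=> j; rewrite inE; apply/imsetP; exists (enum_val j).
      exact: enum_valP.
    by rewrite enum_valK_in.
  move=> x y xA yA nexy; rewrite !inE subUset !sub1set xA yA !cards2 nexy.
  suff -> : enum_rank_in iA x != enum_rank_in iA y by [].
  by apply: contraNneq nexy => /inj->.
Qed.

Lemma maximal_orderP n (D : {set {set 'I_n}}) (i : 'I_n) r :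
  vertex_complex D ->
  maximal_order (min_nonfaces D) i r <->
  (exists A : {set 'I_n}, [/\ A \in D, i \in A & #|A| = r]) /\
  (forall A : {set 'I_n}, A \in D -> i \in A -> #|A| <= r).
Proof.
move=> hD; split=> [[[H adm] max]|[[A [AD iA <-]] max]].
  split=> [|A AD iA]; first by exists (vertices H); apply: admissible_face.
  by apply: max (face_admissible hD.1 AD iA).
split=> [|r' H /(admissible_face hD)[HD iH <-]]; last exact: max.
by exists (Graph (face_edgesP A)); apply: face_admissible hD.1 AD iA.
Qed.

Lemma pure_constant_order n (D : {set {set 'I_n}}) :
  vertex_complex D -> pure D -> constant_order_condition (min_nonfaces D).
Proof.
move=> hD pureD i j r s.
have facetP l q : maximal_order (min_nonfaces D) l q ->
    exists2 A : {set 'I_n}, facet D A & #|A| = q.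
  move/(maximal_orderP _ _ hD)=> [[A [AD lA Aq]] max]; exists A => //.
  apply/maxsetP; split=> // B BD AB; apply/eqP; rewrite eq_sym eqEcard AB Aq.
  by rewrite max ?(subsetP AB).
by move=> /facetP[A fA <-] /facetP[B fB <-]; apply: pureD.
Qed.

(** When the minimal non-faces are disjoint, each vertex outside a facet F lies
    in exactly one of them, and each of them has exactly one vertex outside F,
    as adding that vertex to F already creates a non-face. *)
Lemma facet_codim n (D : {set {set 'I_n}}) (F : {set 'I_n}) :
  simplicial_complex D -> trivIset (min_nonfaces D) -> facet D F -> #|~: F| = #|min_nonfaces D|.
Proof.
move=> hD triv /maxsetP[FD maxF].
have block x : x \in ~: F -> exists S : {set 'I_n},
    [/\ S \in min_nonfaces D, x \in S & S \subset x |: F].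
  rewrite inE => xF.
  have : x |: F \notin D.
    by apply: contraNN xF => xFD; rewrite -(maxF _ xFD (subsetUr _ _)) setU11.
  case/min_nonfacesP=> S SD SF; exists S; split=> //.
  have /subsetPn[y yS yF] : ~~ (S \subset F).
    by apply: contraNN (min_nonfaceN SD); apply: hD.2.
  by have := subsetP SF y yS; rewrite !inE (negPf yF) orbF => /eqP <-.
have pb S x : S \in min_nonfaces D -> x \in S -> pblock (min_nonfaces D) x = S.
  by move=> SD xS; apply: def_pblock.
have inj : {in ~: F &, injective (pblock (min_nonfaces D))}.
  move=> x y xF yF; have [S [SD xS Sx]] := block x xF; have [T [TD yT _]] := block y yF.
  rewrite (pb S) // (pb T) // => ES; rewrite -ES in yT.
  by have := subsetP Sx y yT; move: yF; rewrite !inE => /negPf->; rewrite orbF => /eqP.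
rewrite -(card_in_imset inj); apply/eq_card => S; apply/imsetP/idP => [[x xF ->]|SD].
  by have [T [TD xT _]] := block x xF; rewrite (pb T).
have /subsetPn[x xS xF] : ~~ (S \subset F).
  by apply: contraNN (min_nonfaceN SD); apply: hD.2.
by exists x; [rewrite inE | rewrite (pb S)].
Qed.

Lemma trivIset_pure n (D : {set {set 'I_n}}) :
  simplicial_complex D -> trivIset (min_nonfaces D) -> pure D.
Proof.
move=> hD triv F G fF fG; rewrite (cardsCs F) (cardsCs G).
by rewrite !(facet_codim hD triv).
Qed.

Lemma trivIset_links n (D : {set {set 'I_n}}) :
  simplicial_complex D -> trivIset (min_nonfaces D) -> links_disjoint D.
Proof.
move=> hD /trivIsetP triv i; apply/trivIsetP => X Y XL YL neXY.
have [EX|neX] := eqVneq X [set i].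
  have neY : Y != [set i] by rewrite -EX eq_sym.
  by have [iY _ _] := min_nonface_linkP hD YL neY; rewrite EX disjoints1.
have [iX [S SD EX] _] := min_nonface_linkP hD XL neX.
have [EY|neY] := eqVneq Y [set i]; first by rewrite EY disjoint_sym disjoints1.
have [_ [T TD EY] _] := min_nonface_linkP hD YL neY.
rewrite EX EY; apply: (disjointWl (subsetDl _ _)); apply: (disjointWr (subsetDl _ _)).
by apply: triv => //; apply: contraNneq neXY => EST; rewrite EX EY EST.
Qed.

(** For a cone point i, no minimal non-face of D changes in the link of i. *)
Lemma links_trivIset_cone n (D : {set {set 'I_n}}) (i : 'I_n) :
  simplicial_complex D -> links_disjoint D ->
  (forall S : {set 'I_n}, S \in min_nonfaces D -> i \notin S) ->
  trivIset (min_nonfaces D).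
Proof.
move=> hD H cone; apply: trivIsetS (H i); apply/subsetP=> S SD.
by apply: min_nonface_link (cone S SD) _ => // T TD iT; have := cone T TD; rewrite iT.
Qed.

Lemma facet_link n (D : {set {set 'I_n}}) (i : 'I_n) (F : {set 'I_n}) :
  facet D F -> i \in F -> facet (link D [set i]) (F :\ i).
Proof.
move=> /maxsetP[FD maxF] iF; apply/maxsetP; split=> [|X].
  by rewrite linkE setD1K // FD !inE eqxx.
rewrite linkE => /andP[iX XD] FX.
by rewrite -(maxF _ XD) ?setU1K // -subDset.
Qed.

(** Links being pure, all facets through i have the same size, and this size is
    the maximal order at i. *)
Lemma constant_order_pure n (D : {set {set 'I_n}}) :
  vertex_complex D -> links_disjoint D ->
  constant_order_condition (min_nonfaces D) -> pure D.
Proof.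
move=> hD H const F G fF fG.
have max i A : facet D A -> i \in A -> maximal_order (min_nonfaces D) i #|A|.
  move=> fA iA; apply/(maximal_orderP _ _ hD); split.
    by exists A; split=> //; apply: maxsetp fA.
  move=> B /(maxset_exists (P := fun X => X \in D))[B' fB' BB'] iB.
  have iB' := subsetP BB' i iB; apply: leq_trans (subset_leq_card BB') _.
  rewrite (cardsD1 i B') (cardsD1 i A) iB' iA.
  by rewrite (trivIset_pure (simplicial_link i hD) (H i) (facet_link fB' iB') (facet_link fA iA)).
have [F0|[i iF]] := set_0Vmem F; have [G0|[j jG]] := set_0Vmem G.
- by rewrite F0 G0.
- have /maxsetP[_ /(_ [set j] (hD.2 j))] := fF; rewrite F0 sub0set => /(_ isT)/setP/(_ j).
  by rewrite !inE eqxx.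
- have /maxsetP[_ /(_ [set i] (hD.2 i))] := fG; rewrite G0 sub0set => /(_ isT)/setP/(_ i).
  by rewrite !inE eqxx.
exact: const (max i F fF iF) (max j G fG jG).
Qed.

(** * From the graph conditions back to the links *)

(** The length-four condition with the distinctness of the four edges reduced to
    i3 != i5: all other coincidences would already produce a chord from i1. *)
Lemma no_chordless_walk n (D : {set {set 'I_n}}) (i1 i2 i3 i4 i5 : 'I_n) :
  vertex_complex D -> length4_path_condition (min_nonfaces D) ->
  edge_rel D i1 i2 -> edge_rel D i2 i3 -> edge_rel D i3 i4 -> edge_rel D i4 i5 ->
  i3 != i5 ->
  ~~ edge_rel D i1 i3 -> ~~ edge_rel D i1 i4 -> ~~ edge_rel D i1 i5 -> False.
Proof.
move=> hD len4 e12 e23 e34 e45 ne35 n13 n14 n15.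
have ne13 : i1 != i3 by apply: contraNneq n14 => ->.
have ne14 : i1 != i4 by apply: contraNneq n13 => ->; rewrite edge_rel_sym.
have ne15 : i1 != i5 by apply: contraNneq n14 => ->; rewrite edge_rel_sym.
have ne24 : i2 != i4 by apply: contraNneq n14 => <-.
have ne12 := edge_neq hD e12; have ne23 := edge_neq hD e23.
have ne34 := edge_neq hD e34.
have sep (a b c d e : 'I_n) : e \in [set a; b] -> e \notin [set c; d] ->
    [set a; b] != [set c; d] by move=> + ecd; apply: contraTneq => ->.
case: (len4 i1 i2 i3 i4 i5 e12 e23 e34 e45); [|exact/negP..].
rewrite /= !inE !negb_or (sep _ _ _ _ i1) ?(sep i1 i2 i3 i4 i1) ?(sep i1 i2 i4 i5 i1);
  rewrite ?(sep i2 i3 i3 i4 i2) ?(sep i2 i3 i4 i5 i3) ?(sep i3 i4 i4 i5 i3) //;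
  by rewrite !inE ?eqxx ?orbT // negb_or ?ne12 ?ne13 ?ne14 ?ne15 ?ne23 ?ne24 ?ne34.
Qed.

Lemma path_crossing (T : Type) (e : rel T) (P : pred T) x p :
  path e x p -> ~~ P x -> P (last x p) -> exists u v, [/\ ~~ P u, P v & e u v].
Proof.
elim: p x => [|y p IH] x /=; first by move=> _ /negP.
case/andP=> exy pth Px Pl; have [Py|nPy] := boolP (P y); first by exists x, y.
exact: IH pth nPy Pl.
Qed.

Lemma maximal_face n (D : {set {set 'I_n}}) (i : 'I_n) :
  vertex_complex D -> exists A : {set 'I_n},
    [/\ A \in D, i \in A & maximal_order (min_nonfaces D) i #|A|].
Proof.
move=> hD; pose P (A : {set 'I_n}) := (A \in D) && (i \in A).
have Pi : P [set i] by rewrite /P hD.2 set11.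
case: (arg_maxnP (fun A : {set 'I_n} => #|A|) Pi) => A /andP[AD iA] max.
exists A; split=> //; apply/(maximal_orderP _ _ hD); split; first by exists A.
by move=> B BD iB; apply: max; rewrite /P BD.
Qed.

(** Replacing the centre b of the spider by its two leaves keeps a face A a face.
    An edge from a leaf to a vertex z of A would produce a walk of length four
    starting at x without a chord from x.  A larger minimal non-face U through a
    leaf would have b in C(U), and then b would be adjacent to x. *)
Lemma spider_face n (D : {set {set 'I_n}}) (x y b a c : 'I_n) (A : {set 'I_n}) :
  vertex_complex D -> isolating_condition (min_nonfaces D) ->
  length4_path_condition (min_nonfaces D) ->
  edge_rel D x y -> edge_rel D y b -> edge_rel D b a -> edge_rel D b c ->
  a != c -> ~~ edge_rel D a c ->
  ~~ edge_rel D x a -> ~~ edge_rel D x b -> ~~ edge_rel D x c ->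
  A \in D -> b \in A -> a |: (c |: A :\ b) \in D.
Proof.
move=> hD iso len4 exy eyb eba ebc neac nac nxa nxb nxc AD bA.
have neba := edge_neq hD eba; have nebc := edge_neq hD ebc.
(* a neighbour z of a leaf u is adjacent to x, by the walk x - y - b - u - z;
   then x - z - u - b - w, with w the other leaf, has no chord from x *)
have leaf u w z : edge_rel D b u -> edge_rel D b w -> u != w ->
    ~~ edge_rel D x u -> ~~ edge_rel D x w -> b != z -> ~~ edge_rel D u z.
  move=> ebu ebw neuw nxu nxw nebz; apply/negP => euz.
  have [exz|nxz] := boolP (edge_rel D x z); last first.
    exact: no_chordless_walk hD len4 exy eyb ebu euz nebz nxb nxu nxz.
  by apply: (no_chordless_walk hD len4 exz _ _ ebw neuw nxu nxb nxw); rewrite edge_rel_sym.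
apply: contraT => /min_nonfacesP[U UD UA].
have bU : b \notin U.
  by apply/negP => /(subsetP UA); rewrite !inE eqxx (negPf neba) (negPf nebc).
have [m [mU ebm nxm]] : exists m, [/\ m \in U, edge_rel D b m & ~~ edge_rel D x m].
  have [aU|aU] := boolP (a \in U); first by exists a.
  have [cU|cU] := boolP (c \in U); first by exists c.
  case/negP: (min_nonfaceN UD); apply: hD.1.2 AD _; apply/subsetP => v vU.
  have := subsetP UA v vU; rewrite !inE => /or3P[/eqP E|/eqP E|/andP[]//].
    by rewrite -E vU in aU.
  by rewrite -E vU in cU.
have [U3|/(min_nonface_edge hD UD)[u [v EU]]] := boolP (3 <= #|U|).
  have [C [_ _ [edgeC meetC] farC]] := iso U UD U3.
  have bC : b \in C.
    have neU : [set b; m] != U by apply: contraNneq bU => <-; apply: set21.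
    have meet : U :&: [set b; m] != set0 by apply/set0Pn; exists m; rewrite inE mU set22.
    have [i [j [iC jU E]]] := meetC _ ebm neU meet.
    have : b \in [set i; j] by rewrite -E set21.
    by rewrite !inE => /orP[] /eqP Eb; [rewrite Eb | rewrite -Eb (negPf bU) in jU].
  case/negP: nxb; rewrite edge_rel_sym.
  have [xU|xU] := boolP (x \in U); first exact: edgeC.
  apply: farC bC; rewrite inE (negPf xU) orbF; apply: contraNN nxm => xC.
  exact: edgeC.
have leafA z : z \in A :\ b -> ~~ edge_rel D a z && ~~ edge_rel D c z.
  rewrite !inE eq_sym => /andP[nebz zA].
  by rewrite (leaf a c) // (leaf c a) // eq_sym.
have uvD : edge_rel D u v by rewrite /edge_rel -EU.
have neuv := edge_neq hD uvD.
have nca : ~~ edge_rel D c a by rewrite edge_rel_sym.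
have [uA vA] : u \in a |: (c |: A :\ b) /\ v \in a |: (c |: A :\ b).
  by split; apply: (subsetP UA); rewrite EU !inE eqxx ?orbT.
case/setU1P: uA => [Eu|/setU1P[Eu|uA]]; case/setU1P: vA => [Ev|/setU1P[Ev|vA]].
- by rewrite Eu Ev eqxx in neuv.
- by rewrite Eu Ev (negPf nac) in uvD.
- by have := uvD; rewrite Eu; case/andP: (leafA v vA) => /negPf->.
- by rewrite Eu Ev (negPf nca) in uvD.
- by rewrite Eu Ev eqxx in neuv.
- by have := uvD; rewrite Eu; case/andP: (leafA v vA) => _ /negPf->.
- by have := uvD; rewrite Ev edge_rel_sym; case/andP: (leafA u uA) => /negPf->.
- by have := uvD; rewrite Ev edge_rel_sym; case/andP: (leafA u uA) => _ /negPf->.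
case/negP: (min_nonfaceN UD); apply: hD.1.2 AD _.
by move: uA vA; rewrite EU subUset !sub1set => /setD1P[_ ->] /setD1P[_ ->].
Qed.

Lemma spider_order n (D : {set {set 'I_n}}) (x y b a c : 'I_n) :
  vertex_complex D -> isolating_condition (min_nonfaces D) ->
  length4_path_condition (min_nonfaces D) ->
  constant_order_condition (min_nonfaces D) ->
  edge_rel D x y -> edge_rel D y b -> edge_rel D b a -> edge_rel D b c ->
  a != c -> ~~ edge_rel D a c ->
  ~~ edge_rel D x a -> ~~ edge_rel D x b -> ~~ edge_rel D x c -> False.
Proof.
move=> hD iso len4 const exy eyb eba ebc neac nac nxa nxb nxc.
have [A [AD bA maxA]] := maximal_face b hD; have [B [BD aB maxB]] := maximal_face a hD.
have := spider_face hD iso len4 exy eyb eba ebc neac nac nxa nxb nxc AD bA.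
have notA m : edge_rel D b m -> m \notin A.
  move=> ebm; apply: contraTN AD => mA; apply: nonfaceW hD.1 (min_nonfaceN ebm) _.
  by rewrite subUset !sub1set bA.
move/((maximal_orderP _ _ hD).1 maxB).2; rewrite setU11 => /(_ isT).
rewrite -(const _ _ _ _ maxA maxB) !cardsU1 !inE (negPf neac) (negPf (notA _ eba)).
by rewrite (negPf (notA _ ebc)) !andbF /= (cardsD1 b A) bA !add1n ltnn.
Qed.

(** [big] excludes larger minimal non-faces by the isolating condition, and
    [edges] shows that what remains is a pair of edges at z whose ends are not
    adjacent to i.  On a walk from i to z, the step u - v that first touches the
    set of vertices equal or adjacent to a, z, c gives the spider: by the
    length-four condition, v is adjacent to neither a nor c, and a is not
    adjacent to c. *)
Lemma conditions_links n (D : {set {set 'I_n}}) :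
  vertex_complex D -> isolating_condition (min_nonfaces D) ->
  linked_condition (min_nonfaces D) ->
  length4_path_condition (min_nonfaces D) ->
  constant_order_condition (min_nonfaces D) -> links_disjoint D.
Proof.
move=> hD iso linked len4 const i.
have big (S T : {set 'I_n}) z : S \in min_nonfaces D -> T \in min_nonfaces D ->
    3 <= #|S| -> S :\ i != T :\ i -> z \in S :\ i -> z \in T :\ i ->
    (forall U : {set 'I_n}, U \in min_nonfaces D ->
       U :\ i \subset S :\ i -> U :\ i = S :\ i) ->
    (forall U : {set 'I_n}, U \in min_nonfaces D ->
       U :\ i \subset T :\ i -> U :\ i = T :\ i) ->
    False.
  move=> SD TD S3 neST /setD1P[nezi zS] /setD1P[_ zT] minS minT.
  have [C [_ CS [edgeC meetC] farC]] := iso S SD S3.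
  have CnS t : t \in C -> t \notin S.
    by move=> tC; apply/negP => tS; have := in_set0 t; rewrite -CS inE tC tS.
  have [iC|iC] := boolP (i \in C).
    have Ez : [set i; z] :\ i = [set z].
      by apply/setP=> w; rewrite !inE; case: eqVneq => [->|_] //=; rewrite eq_sym (negPf nezi).
    have := minS _ (edgeC i iC z zS); rewrite Ez sub1set !inE nezi zS => /(_ isT) E.
    have := S3; rewrite (cardsD1 i S) -E cards1.
    by case: (i \in S).
  have neTS : T != S by apply: contraNneq neST => ->.
  have meet : S :&: T != set0 by apply/set0Pn; exists z; rewrite inE zS.
  have [c [j [cC jS ET]]] := meetC T TD neTS meet.
  have neci : c != i by apply: contraNneq iC => <-.
  have ciD : [set c; i] \in min_nonfaces D.
    have [iS|iS] := boolP (i \in S); first exact: edgeC.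
    by apply: farC => //; rewrite inE negb_or iC.
  have Ec : [set c; i] :\ i = [set c].
    by apply/setP=> w; rewrite !inE; case: eqVneq => [->|_] //=; rewrite ?orbF // eq_sym (negPf neci).
  have := minT _ ciD; rewrite Ec sub1set !inE neci ET set21 => /(_ isT) E.
  have : z \in [set c] by rewrite E !inE nezi -in_set2 -ET.
  by rewrite inE => /eqP Ez; have := CnS c cC; rewrite -Ez zS.
have edges (S T : {set 'I_n}) z : S \in min_nonfaces D -> T \in min_nonfaces D ->
    ~~ (3 <= #|S|) -> S :\ i != T :\ i -> z \in S :\ i -> z \in T :\ i ->
    (forall U : {set 'I_n}, U \in min_nonfaces D ->
       U :\ i \subset S :\ i -> U :\ i = S :\ i) ->
    (forall U : {set 'I_n}, U \in min_nonfaces D ->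
       U :\ i \subset T :\ i -> U :\ i = T :\ i) ->
    i \notin S /\ exists2 a, S = [set z; a] & ~~ edge_rel D i a /\ ~~ edge_rel D i z.
  move=> SD TD S2 neST /setD1P[nezi zS] /setD1P[_ zT] minS minT.
  have [a aS neaz] := min_nonface_other z hD SD.
  have ES : S = [set z; a].
    apply/esym/eqP; rewrite eqEcard subUset !sub1set zS aS cards2 eq_sym neaz.
    by rewrite -ltnNge ltnS in S2.
  have iS : i \notin S.
    apply: contraNN neST => iS; apply/eqP/minT => //; apply/subsetP => w.
    rewrite ES in iS *; move: iS; rewrite !inE (eq_sym i) (negPf nezi) => /eqP ->.
    by case: eqVneq => //= _; rewrite orbF => /eqP->; rewrite zT.
  have nadj m : m \in S -> ~~ edge_rel D i m.
    move=> mS; apply/negP => imD; have neim := edge_neq hD imD.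
    have Em : [set i; m] :\ i = [set m].
      by apply/setP=> w; rewrite !inE; case: eqVneq => [->|_] //=; rewrite ?orbF (negPf neim).
    have := minS _ imD; rewrite Em sub1set !inE eq_sym neim mS => /(_ isT) E.
    have := min_nonface_card hD SD; rewrite (cardsD1 i S) -E cards1 (negPf iS).
    by [].
  by split=> //; exists a; rewrite // !nadj.
apply/trivIsetP => X Y XL YL neXY; apply: contraT.
rewrite -setI_eq0 => /set0Pn[z /setIP[zX zY]]; exfalso.
have neX : X != [set i].
  apply: contraNneq neXY => EX; rewrite EX inE in zX; rewrite (eqP zX) in zY.
  have [-> //|neY] := eqVneq Y [set i]; first by rewrite EX.
  by have [iY _ _] := min_nonface_linkP hD.1 YL neY; rewrite zY in iY.
have [iX [S SD EX] minX] := min_nonface_linkP hD.1 XL neX.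
have neY : Y != [set i].
  by apply: contraNneq iX => EY; move: zY; rewrite EY inE => /eqP <-.
have [iY [T TD EY] minY] := min_nonface_linkP hD.1 YL neY.
rewrite EX EY in neXY zX zY minX minY.
have neYX : T :\ i != S :\ i by rewrite eq_sym.
have [S3|S2] := boolP (3 <= #|S|); first exact: big SD TD S3 neXY zX zY minX minY.
have [T3|T2] := boolP (3 <= #|T|); first exact: big TD SD T3 neYX zY zX minY minX.
have [iS [a ES [nia niz]]] := edges S T z SD TD S2 neXY zX zY minX minY.
have [iT [c ET [nic _]]] := edges T S z TD SD T2 neYX zY zX minY minX.
have nzc : edge_rel D z c by rewrite /edge_rel -ET.
have nza : edge_rel D z a by rewrite /edge_rel -ES.
have neac : a != c by apply: contraNneq neXY => Eac; rewrite ES ET Eac.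
have nezi : z != i by case/setD1P: zX.
pose leg := [set a; z; c].
have legE v : (v \in leg) = [|| v == a, v == z | v == c] by rewrite !inE orbA.
pose near v := (v \in leg) || [exists w in leg, edge_rel D v w].
have nearP v w : w \in leg -> edge_rel D v w -> near v.
  by move=> wleg evw; apply/orP; right; apply/exists_inP; exists w.
have nni : ~~ near i.
  rewrite negb_or; apply/andP; split.
    move: iS iT; rewrite ES ET legE !inE !negb_or => /andP[-> ->] /andP[_ ->].
    by [].
  by apply/exists_inPn => w; rewrite legE => /or3P[] /eqP->.
have neiz : i != z by rewrite eq_sym.
have [p [pth lst]] := linked i z neiz.
have nz : near (last i p) by rewrite lst /near legE eqxx orbT.
have [u [v [nnu nv euv]]] := path_crossing (e := edge_rel D) pth nni nz.
have nadj w : w \in leg -> ~~ edge_rel D u w.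
  by move=> wleg; apply: contraNN nnu => /nearP; apply.
have nua : ~~ edge_rel D u a by apply: nadj; rewrite legE eqxx.
have nuz : ~~ edge_rel D u z by apply: nadj; rewrite legE eqxx orbT.
have nuc : ~~ edge_rel D u c by apply: nadj; rewrite legE eqxx !orbT.
have naz : edge_rel D a z by rewrite edge_rel_sym.
have ncz : edge_rel D c z by rewrite edge_rel_sym.
have neca : c != a by rewrite eq_sym.
have evz : edge_rel D v z.
  case/orP: nv => [vleg|/exists_inP[w]]; first by rewrite (negPf (nadj v vleg)) in euv.
  rewrite legE => /or3P[] /eqP -> // evw; exfalso.
    exact: no_chordless_walk hD len4 euv evw naz nzc neac nua nuz nuc.
  exact: no_chordless_walk hD len4 euv evw ncz nza neca nuc nuz nua.
have [eac|nac] := boolP (edge_rel D a c).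
  exact: no_chordless_walk hD len4 euv evz nza eac (edge_neq hD nzc) nuz nua nuc.
exact: spider_order hD iso len4 const euv evz nza nzc neac nac nua nuz nuc.
Qed.

Theorem theorem3p16 (k : fieldType) (n : nat) (D : {set {set 'I_n}})
    (hD : simplicial_complex D)
    (hvert : forall i : 'I_n, [set i] \in D)
    (G : seq 'X_{1..n})
    (hG : minimal_monomial_generators (@SR_ideal k n D) G) :
  (D = core D -> ~ complete_intersection k D ->
     (generalized_complete_intersection k D <->
      [/\ isolating_condition (supports G),
          linked_condition (supports G),
          length4_path_condition (supports G) &
          constant_order_condition (supports G)]))
  /\
  (D <> core D ->
     (generalized_complete_intersection k D <-> complete_intersection k D)).
Proof.
have hv : vertex_complex D by split.
rewrite (supports_min_generators hD hG).
have CI (E : {set {set 'I_n}}) : simplicial_complex E ->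
    complete_intersection k E <-> trivIset (min_nonfaces E).
  move=> hE; split; first exact: complete_intersection_trivIset.
  exact: trivIset_complete_intersection.
have gCI : generalized_complete_intersection k D <-> pure D /\ links_disjoint D.
  by split=> -[pureD H]; split=> // i; apply/CI/H; apply: simplicial_link.
split=> [_|ncoreD].
  rewrite CI // => /negP ntriv; rewrite gCI; split=> [[pureD H]|[iso linked len4 const]].
    have iso := gci_isolating hv H ntriv.
    by split=> //; [apply: gci_linked | apply: gci_length4 | apply: pure_constant_order].
  have H := conditions_links hv iso linked len4 const.
  by split=> //; apply: constant_order_pure.
rewrite gCI CI //; split=> [[_ H]|triv]; last first.
  by split; [apply: trivIset_pure | apply: trivIset_links].
case: (boolP [exists i : 'I_n, [forall S in min_nonfaces D, i \notin S]]).
  by move=> /existsP[i /forall_inP noS]; apply: links_trivIset_cone H noS.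
move/existsPn => full; case: ncoreD; apply/(core_fullP hv) => i.
have := full i; rewrite negb_forall_in => /exists_inP[S SD]; rewrite negbK.
by exists S.
Qed.
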